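(* Let $\mathsf{G}$ be any of the sequent calculi $\mathsf{G.N},\mathsf{G.NN},\mathsf{G.NT},\mathsf{G.NW},\mathsf{G.NC},\mathsf{G.NA},\mathsf{G.NNA}$. The cut rule, which from $\Gamma\Rightarrow A,\Delta$ and $\Gamma',A\Rightarrow\Delta'$ infers $\Gamma,\Gamma'\Rightarrow\Delta,\Delta'$, is admissible in $\mathsf G$.
   Context: Language: formulas $A ::= p \mid \bot \mid A\to A \mid A \preccurlyeq A$ over countably many atoms. Sequents $\Gamma\Rightarrow\Delta$: $\Gamma,\Delta$ finite multisets of formulas. Rules (write $\Sigma^{\preccurlyeq}$ for $C_1\preccurlyeq D_1,\dots,C_n\preccurlyeq D_n$; $\Gamma^{\preccurlyeq}$, $\Delta^{\preccurlyeq}$ for the $\preccurlyeq$-formulas in $\Gamma$, $\Delta$): init: $\Gamma,p\Rightarrow p,\Delta$; $\bot_L$: $\Gamma,\bot\Rightarrow\Delta$; $\to_L$: from $\Gamma\Rightarrow A,\Delta$ and $\Gamma,B\Rightarrow\Delta$ infer $\Gamma,A\to B\Rightarrow\Delta$; $\to_R$: from $\Gamma,A\Rightarrow B,\Delta$ infer $\Gamma\Rightarrow A\to B,\Delta$. $\mathrm{CP}_n$: from $\{C_k\Rightarrow A,D_1,\dots,D_{k-1}\}_{1\le k\le n}$ and $B\Rightarrow A,D_1,\dots,D_n$ infer $\Gamma,\Sigma^{\preccurlyeq}\Rightarrow A\preccurlyeq B,\Delta$. $\mathrm N_n$: from $\{C_k\Rightarrow D_1,\dots,D_{k-1}\}_{k\le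 n}$ and $\Rightarrow D_1,\dots,D_n$ infer $\Gamma,\Sigma^{\preccurlyeq}\Rightarrow\Delta$. $\mathrm T_n$: from $\{C_k\Rightarrow D_1,\dots,D_{k-1}\}_{k\le n}$ and $\Gamma,\Sigma^{\preccurlyeq}\Rightarrow D_1,\dots,D_n,\Delta$ infer $\Gamma,\Sigma^{\preccurlyeq}\Rightarrow\Delta$. $\mathrm W_n$: from $\{C_k\Rightarrow A,D_1,\dots,D_{k-1}\}_{k\le n}$ and $\Gamma,\Sigma^{\preccurlyeq}\Rightarrow A,A\preccurlyeq B,D_1,\dots,D_n,\Delta$ infer $\Gamma,\Sigma^{\preccurlyeq}\Rightarrow A\preccurlyeq B,\Delta$. $\mathrm W_0$: from $\Gamma\Rightarrow A\preccurlyeq B,A,\Delta$ infer $\Gamma\Rightarrow A\preccurlyeq B,\Delta$. $\mathrm C_0$: from $\Gamma,A\preccurlyeq B,A\Rightarrow\Delta$ and $\Gamma,A\preccurlyeq B\Rightarrow B,\Delta$ infer $\Gamma,A\preccurlyeq B\Rightarrow\Delta$. $\mathrm A_n$: from $\{\Gamma^{\preccurlyeq},\Sigma^{\preccurlyeq},C_k\Rightarrow A\preccurlyeq B,A,D_1,\dots,D_{k-1},\Delta^{\preccurlyeq}\}_{k\le n}$ and $\Gamma^{\preccurlyeq},\Sigma^{\preccurlyeq},B\Rightarrow A\preccurlyeq B,A,D_1,\dots,D_n,\Delta^{\preccurlyeq}$ infer $\Gamma,\Sigma^{\preccurlyeq}\Rightarrow A\preccurlyeq B,\Delta$. $\mathrm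 N^A_n$: from $\{\Gamma^{\preccurlyeq},\Sigma^{\preccurlyeq},C_k\Rightarrow D_1,\dots,D_{k-1},\Delta^{\preccurlyeq}\}_{k\le n}$ and $\Gamma^{\preccurlyeq},\Sigma^{\preccurlyeq}\Rightarrow D_1,\dots,D_n,\Delta^{\preccurlyeq}$ infer $\Gamma,\Sigma^{\preccurlyeq}\Rightarrow\Delta$. Calculi: $\mathsf{G.N}=\{\mathrm{init},\bot_L,\to_L,\to_R\}\cup\{\mathrm{CP}_n\mid n\ge0\}$; $\mathsf{G.NN}=\mathsf{G.N}\cup\{\mathrm N_n\mid n\ge1\}$; $\mathsf{G.NT}=\mathsf{G.N}\cup\{\mathrm T_n\mid n\ge1\}$; $\mathsf{G.NW}=\mathsf{G.N}\cup\{\mathrm W_n\mid n\ge0\}\cup\{\mathrm T_n\mid n\ge1\}$; $\mathsf{G.NC}=\mathsf{G.N}\cup\{\mathrm W_0,\mathrm C_0\}$; $\mathsf{G.NA}=\{\mathrm{init},\bot_L,\to_L,\to_R\}\cup\{\mathrm A_n\mid n\ge0\}$; $\mathsf{G.NNA}=\mathsf{G.NA}\cup\{\mathrm N^A_n\mid n\ge1\}$. A rule is admissible if whenever its premisses are derivable its conclusion is derivable. *)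

(* Defs.v *)
From HB Require Import structures.
From mathcomp Require Import all_boot.
From mathcomp Require Import finmap multiset.

Set Implicit Arguments.
Unset Strict Implicit.
Unset Printing Implicit Defensive.

Declare Scope sequent_scope.
Delimit Scope sequent_scope with sequent.
Local Open Scope mset_scope.
Local Open Scope sequent_scope.

Inductive form : Type :=
| Atom of nat
| Bot
| Imp of form & form
| Prec of form & form.

Notation "A ≼ B" := (Prec A B) (at level 49, no associativity) : sequent_scope.

(* The choiceType structure required by {mset form}. *)
Fixpoint tree_of_form (A : form) : GenTree.tree nat :=
  match A with
  | Atom p => GenTree.Leaf p
  | Bot => GenTree.Node 0 [::]
  | Imp A B => GenTree.Node 1 [:: tree_of_form A; tree_of_form B]
  | Prec A B => GenTree.Node 2 [:: tree_of_form A; tree_of_form B]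
  end.

Fixpoint form_of_tree (t : GenTree.tree nat) : form :=
  match t with
  | GenTree.Leaf p => Atom p
  | GenTree.Node 1 [:: t1; t2] => Imp (form_of_tree t1) (form_of_tree t2)
  | GenTree.Node 2 [:: t1; t2] => Prec (form_of_tree t1) (form_of_tree t2)
  | _ => Bot
  end.

Lemma tree_of_formK : cancel tree_of_form form_of_tree.
Proof. by elim=> //= [A -> B ->|A -> B ->]. Qed.

HB.instance Definition _ := Countable.copy form (can_type tree_of_formK).

Notation ctx := {mset form}.

Definition sequent : Type := (ctx * ctx)%type.

Notation "Γ ⇒ Δ" := ((Γ, Δ) : sequent) (at level 70, no associativity) :
  sequent_scope.

(* A rule is the set of its instances, given as (premisses, conclusion). *)
Definition rule : Type := seq sequent -> sequent -> Prop.

Inductive derivable (G : rule) : sequent -> Prop :=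
| Derive (ps : seq sequent) (c : sequent) :
    G ps c -> (forall s, s \in ps -> derivable G s) -> derivable G c.

Definition admissible (G r : rule) : Prop :=
  forall (ps : seq sequent) (c : sequent),
    r ps c -> (forall s, s \in ps -> derivable G s) -> derivable G c.

Definition is_prec (A : form) : bool := if A is Prec _ _ then true else false.

(* Γ^≼ : the ≼-formulas of Γ, with their multiplicities. *)
Definition precs (Γ : ctx) : ctx := seq_mset [seq A <- Γ | is_prec A].

(* A list S = [:: (C_1, D_1); ...; (C_n, D_n)] stands for the indexed family of
   the C_k and D_k. *)
Definition block : Type := seq (form * form).

(* Σ^≼ = C_1 ≼ D_1, ..., C_n ≼ D_n *)
Definition Sig (S : block) : ctx := seq_mset [seq P.1 ≼ P.2 | P <- S].

(* D_1, ..., D_k *)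
Definition Ds (S : block) (k : nat) : ctx := seq_mset (take k (unzip2 S)).

(* The premisses Γ, C_k ⇒ Δ, D_1, ..., D_(k-1) for 1 <= k <= n; the index runs
   over 0 <= k < n below. *)
Definition chain (Γ Δ : ctx) (S : block) : seq sequent :=
  [seq (nth (Bot, Bot) S k).1 +` Γ ⇒ Δ `+` Ds S k | k <- iota 0 (size S)].

Inductive init : rule :=
| Init (Γ Δ : ctx) (p : nat) :
    init [::] (Atom p +` Γ ⇒ Atom p +` Δ).

Inductive botL : rule :=
| BotL (Γ Δ : ctx) :
    botL [::] (Bot +` Γ ⇒ Δ).

Inductive impL : rule :=
| ImpL (Γ Δ : ctx) (A B : form) :
    impL [:: Γ ⇒ A +` Δ; B +` Γ ⇒ Δ] (Imp A B +` Γ ⇒ Δ).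

Inductive impR : rule :=
| ImpR (Γ Δ : ctx) (A B : form) :
    impR [:: A +` Γ ⇒ B +` Δ] (Γ ⇒ Imp A B +` Δ).

Inductive CP_rule (n : nat) : rule :=
| CP_intro (Γ Δ : ctx) (A B : form) (S : block) : size S = n ->
    CP_rule n
      (rcons (chain mset0 [mset A] S)
             ([mset B] ⇒ A +` Ds S n))
      (Γ `+` Sig S ⇒ (A ≼ B) +` Δ).

Inductive N_rule (n : nat) : rule :=
| N_intro (Γ Δ : ctx) (S : block) : size S = n ->
    N_rule n
      (rcons (chain mset0 mset0 S)
             (mset0 ⇒ Ds S n))
      (Γ `+` Sig S ⇒ Δ).

Inductive T_rule (n : nat) : rule :=
| T_intro (Γ Δ : ctx) (S : block) : size S = n ->
    T_rule n
      (rcons (chain mset0 mset0 S)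
             (Γ `+` Sig S ⇒ Ds S n `+` Δ))
      (Γ `+` Sig S ⇒ Δ).

(* The rule W_0 is the instance n = 0: chain and Sig are then empty. *)
Inductive W_rule (n : nat) : rule :=
| W_intro (Γ Δ : ctx) (A B : form) (S : block) : size S = n ->
    W_rule n
      (rcons (chain mset0 [mset A] S)
             (Γ `+` Sig S ⇒ [mset A; A ≼ B] `+` Ds S n `+` Δ))
      (Γ `+` Sig S ⇒ (A ≼ B) +` Δ).

Inductive C0_rule : rule :=
| C0_intro (Γ Δ : ctx) (A B : form) :
    C0_rule [:: [mset A ≼ B; A] `+` Γ ⇒ Δ; (A ≼ B) +` Γ ⇒ B +` Δ]
      ((A ≼ B) +` Γ ⇒ Δ).

Inductive A_rule (n : nat) : rule :=
| A_intro (Γ Δ : ctx) (A B : form) (S : block) : size S = n ->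
    A_rule n
      (rcons (chain (precs Γ `+` Sig S) ([mset A ≼ B; A] `+` precs Δ) S)
             (B +` (precs Γ `+` Sig S) ⇒
                [mset A ≼ B; A] `+` precs Δ `+` Ds S n))
      (Γ `+` Sig S ⇒ (A ≼ B) +` Δ).

Inductive NA_rule (n : nat) : rule :=
| NA_intro (Γ Δ : ctx) (S : block) : size S = n ->
    NA_rule n
      (rcons (chain (precs Γ `+` Sig S) (precs Δ) S)
             (precs Γ `+` Sig S ⇒ precs Δ `+` Ds S n))
      (Γ `+` Sig S ⇒ Δ).

Definition runion (r1 r2 : rule) : rule := fun ps c => r1 ps c \/ r2 ps c.

(* { r n | n >= m } *)
Definition rfamily (m : nat) (r : nat -> rule) : rule :=
  fun ps c => exists2 n, m <= n & r n ps c.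

Notation "r1 ∪ r2" := (runion r1 r2) (at level 50, left associativity) :
  sequent_scope.

Definition G_prop : rule := init ∪ botL ∪ impL ∪ impR.
Definition G_N : rule := G_prop ∪ rfamily 0 CP_rule.
Definition G_NN : rule := G_N ∪ rfamily 1 N_rule.
Definition G_NT : rule := G_N ∪ rfamily 1 T_rule.
Definition G_NW : rule := G_N ∪ rfamily 0 W_rule ∪ rfamily 1 T_rule.
Definition G_NC : rule := G_N ∪ W_rule 0 ∪ C0_rule.
Definition G_NA : rule := G_prop ∪ rfamily 0 A_rule.
Definition G_NNA : rule := G_NA ∪ rfamily 1 NA_rule.

Inductive calculus : Type := cN | cNN | cNT | cNW | cNC | cNA | cNNA.

Definition rules (L : calculus) : rule :=
  match L with
  | cN => G_N
  | cNN => G_NN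
  | cNT => G_NT
  | cNW => G_NW
  | cNC => G_NC
  | cNA => G_NA
  | cNNA => G_NNA
  end.

Inductive cut : rule :=
| Cut (Γ Γ' Δ Δ' : ctx) (A : form) :
    cut [:: Γ ⇒ A +` Δ; A +` Γ' ⇒ Δ'] (Γ `+` Γ' ⇒ Δ `+` Δ').

(* Main.v *)
(** Derivability is compared with that of a cumulative calculus [der] on
    sequents read as pairs of sets: premisses keep the principal formula, so
    that weakening and contraction are immediate.  Cut is eliminated in [der] by
    induction on the cut formula.  Implications are cut by inversion.  For
    [A ≼ B], an induction on both derivations leads to a rule that introduces
    [A ≼ B] on the right from a block [C_1 ≼ D_1, ..., C_n ≼ D_n], and a rule
    that uses [A ≼ B] on the left as a member of another block; splicing the
    first block into the second one in the place of [A ≼ B] yields an instance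
    of a rule of the same calculus, whose premisses are obtained by cuts on [A]
    and [B].

    The return to multisets needs contraction on implications only.  Instead of
    proving it by height-preserving inversion, one shows that a derivable
    sequent is derivable for every multiset sequent that covers it, where an
    implication counts as covered once its components are, as after its own
    decomposition. *)

From mathcomp Require Import all_boot.
From mathcomp Require Import finmap multiset.
Require Import Defs.

Set Implicit Arguments.
Unset Strict Implicit.
Unset Printing Implicit Defensive.

Local Open Scope mset_scope.
Local Open Scope sequent_scope.

(** * The seven calculi as one cumulative calculus on sets of formulas *)

Definition is_abs (L : calculus) := if L is (cNA | cNNA) then true else false.
Definition has_N (L : calculus) := if L is (cNN | cNNA) then true else false.
Definition has_T (L : calculus) :=
  if L is (cNT | cNW | cNC) then true else false.
Definition has_W (L : calculus) := if L is (cNW | cNC) then true else false.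
Definition has_C (L : calculus) := if L is cNC then true else false.

(* [Some (A, B)] is the principal formula [A ≼ B] of CP, A and W; [None] stands
   for N, NA and T, which have none on the right. *)
Definition principal (o : option (form * form)) (Δ : seq form) : bool :=
  if o is Some (A, B) then A ≼ B \in Δ else true.
Definition succ_of (o : option (form * form)) : seq form :=
  if o is Some (A, _) then [:: A] else [::].
Definition ante_of (o : option (form * form)) : seq form :=
  if o is Some (_, B) then [:: B] else [::].
Definition jump_ok (L : calculus) (o : option (form * form)) : bool :=
  if o is Some _ then true else has_N L.
Definition stay_ok (L : calculus) (o : option (form * form)) : bool :=
  if o is Some _ then has_W L else has_T L.
(** The context that passes into the premisses of a jump; the rest of the conclusion is lost
    there. *)
Definition box (L : calculus) (Γ : seq form) : seq form :=
  if is_abs L then [seq A <- Γ | is_prec A] else [::].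
Definition sigs (S : block) : seq form := [seq P.1 ≼ P.2 | P <- S].

(* [DJump] covers CP, N, A and NA; [DStay] covers T and W.  T_n and W_n are
   included in full in the calculus NC, where they follow from C_0 and W_0.  A
   block is listed from its last pair to its first, so that its tails are the
   initial segments [C_1 ≼ D_1, ..., C_k ≼ D_k] of the rule. *)
Inductive der (L : calculus) : seq form -> seq form -> Prop :=
| DInit Γ Δ p : Atom p \in Γ -> Atom p \in Δ -> der L Γ Δ
| DBot Γ Δ : Bot \in Γ -> der L Γ Δ
| DImpL Γ Δ A B : Imp A B \in Γ ->
    der L Γ (A :: Δ) -> der L (B :: Γ) Δ -> der L Γ Δ
| DImpR Γ Δ A B : Imp A B \in Δ -> der L (A :: Γ) (B :: Δ) -> der L Γ Δ
| DJump Γ Δ o S : jump_ok L o -> principal o Δ -> {subset sigs S <= Γ} ->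
    (forall C D S1 S2, S = S2 ++ (C, D) :: S1 ->
       der L (C :: box L Γ) (unzip2 S1 ++ succ_of o ++ box L Δ)) ->
    der L (ante_of o ++ box L Γ) (unzip2 S ++ succ_of o ++ box L Δ) ->
    der L Γ Δ
| DStay Γ Δ o S : stay_ok L o -> principal o Δ -> {subset sigs S <= Γ} ->
    (forall C D S1 S2, S = S2 ++ (C, D) :: S1 ->
       der L [:: C] (unzip2 S1 ++ succ_of o)) ->
    der L Γ (unzip2 S ++ succ_of o ++ Δ) ->
    der L Γ Δ
| DC0 Γ Δ A B : has_C L -> A ≼ B \in Γ ->
    der L (A :: Γ) Δ -> der L Γ (B :: Δ) -> der L Γ Δ.

(** The indexed premisses of a block. As [S] runs from its last pair to its first, [S1] holds the
    pairs of smaller index, whose second components stand on the right. *)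
Definition chained L (Γ Δ : seq form) (S : block) : Prop :=
  forall C D S1 S2, S = S2 ++ (C, D) :: S1 -> der L (C :: Γ) (unzip2 S1 ++ Δ).

Ltac bool_cases :=
  repeat match goal with
  | |- context [?x \in ?X] => case: (x \in X) => //=
  | |- context [?x == ?y] => case: (x == y) => //=
  end.

Ltac sub :=
  let x := fresh "x" in
  move=> x;
  repeat match goal with
  | H : {subset _ <= _} |- _ => move: (H x); clear H
  end;
  rewrite ?(inE, mem_cat, in_nil);
  try by [bool_cases].

(** * Weakening and contraction in [der] *)

Lemma box_sub L Γ Γ' : {subset Γ <= Γ'} -> {subset box L Γ <= box L Γ'}.
Proof.
rewrite /box; case: (is_abs L) => // h x; rewrite !mem_filter.
by case/andP=> -> /h.
Qed.

Lemma box_sub_cons L P Γ Γ' :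
  {subset Γ <= P :: Γ'} -> {subset box L Γ <= P :: box L Γ'}.
Proof.
rewrite /box; case: (is_abs L) => // h x; rewrite inE !mem_filter.
by case/andP=> -> /h; rewrite inE.
Qed.

Lemma box_idem L Γ : box L (box L Γ) = box L Γ.
Proof. by rewrite /box; case: (is_abs L) => //; rewrite filter_id. Qed.

Lemma mem_box L P Γ : ~~ is_prec P -> P \in box L Γ = false.
Proof.
by rewrite /box; case: (is_abs L) => // /negbTE h; rewrite mem_filter h.
Qed.

Lemma box_sub_nonprec L P Γ Γ' : ~~ is_prec P ->
  {subset Γ <= P :: Γ'} -> {subset box L Γ <= box L Γ'}.
Proof.
move=> nP h x hx; have := box_sub_cons h hx; rewrite inE => /orP[/eqP e|//].
by move: hx; rewrite e mem_box.
Qed.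

Lemma sub_sigs_nonprec P S Γ : ~~ is_prec P ->
  {subset sigs S <= P :: Γ} -> {subset sigs S <= Γ}.
Proof.
move=> nP h x hx; have := h x hx; rewrite inE => /orP[/eqP e|//].
by move: hx nP; rewrite e => /mapP[q _ ->].
Qed.

Lemma principal_sub o Δ Δ' :
  {subset Δ <= Δ'} -> principal o Δ -> principal o Δ'.
Proof. by case: o => [[A B]|] //= h /h. Qed.

Lemma principal_sub_cons o P Δ Δ' : {subset Δ <= P :: Δ'} -> principal o Δ ->
  principal o Δ' \/ exists A B, o = Some (A, B) /\ P = A ≼ B.
Proof.
case: o => [[A B]|] //= h; last by left.
by move/h; rewrite inE => /orP[/eqP <-|]; [right; exists A, B | left].
Qed.

Lemma principal_sub_nonprec o P Δ Δ' : ~~ is_prec P ->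
  {subset Δ <= P :: Δ'} -> principal o Δ -> principal o Δ'.
Proof.
move=> nP h hp; case: (principal_sub_cons h hp) => // [[A [B [_ e]]]].
by rewrite e in nP.
Qed.

(** All side conditions of [der] are memberships or inclusions and [box] is monotone, so every rule
    can be repeated in larger contexts. Contraction is included, since only sets are compared. *)
Lemma weak L Γ Δ : der L Γ Δ -> forall Γ' Δ',
  {subset Γ <= Γ'} -> {subset Δ <= Δ'} -> der L Γ' Δ'.
Proof.
elim=> {Γ Δ}.
- by move=> Γ Δ p h1 h2 Γ' Δ' s1 s2; apply: (@DInit L _ _ p); auto.
- by move=> Γ Δ h1 Γ' Δ' s1 s2; apply: DBot; auto.
- move=> Γ Δ A B h _ IH1 _ IH2 Γ' Δ' s1 s2.
  by apply: (DImpL (s1 _ h)); [apply: IH1 | apply: IH2]; sub.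
- move=> Γ Δ A B h _ IH1 Γ' Δ' s1 s2.
  by apply: (DImpR (s2 _ h)); apply: IH1; sub.
- move=> Γ Δ o S ok pr sS _ IH1 _ IH2 Γ' Δ' s1 s2.
  have b1 := @box_sub L _ _ s1; have b2 := @box_sub L _ _ s2.
  apply: (@DJump L _ _ o S) => //.
  + exact: principal_sub pr.
  + by move=> x /sS /s1.
  + by move=> C D S1 S2 e; apply: (IH1 _ _ _ _ e); clear -b1 b2; sub.
  + by apply: IH2; clear -b1 b2; sub.
- move=> Γ Δ o S ok pr sS h1 IH1 _ IH2 Γ' Δ' s1 s2.
  apply: (@DStay L _ _ o S) => //.
  + exact: principal_sub pr.
  + by move=> x /sS /s1.
  + by apply: IH2 => //; clear -s2; sub.
- move=> Γ Δ A B c h _ IH1 _ IH2 Γ' Δ' s1 s2.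
  by apply: (DC0 c (s1 _ h)); [apply: IH1 | apply: IH2]; sub.
Qed.

(** * Replacement of a formula that is not a ≼-formula; inversion of implications *)

Ltac weaken H := apply: (weak H); sub.

(* [Q] on the right is traded for [Γe ⇒ Δe], provided that this can be done in
   the two rules in which [Q] is principal. *)
Lemma replace_right L Q Γe Δe (K : seq form -> seq form -> Prop) :
  ~~ is_prec Q ->
  (forall Γ Δ Γ' Δ', {subset Γ <= Γ'} -> {subset Δ <= Δ'} ->
     K Γ Δ -> K Γ' Δ') ->
  (forall p Γ Δ, Q = Atom p -> Atom p \in Γ -> K Γ Δ ->
     der L (Γe ++ Γ) (Δe ++ Δ)) ->
  (forall A B Γ Δ, Q = Imp A B -> der L (Γe ++ A :: Γ) (Δe ++ B :: Δ) ->
     der L (Γe ++ Γ) (Δe ++ Δ)) ->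
  forall Γ Δ, der L Γ Δ -> forall Γ' Δ',
  {subset Γ <= Γ'} -> {subset Δ <= Q :: Δ'} -> K Γ' Δ' ->
  der L (Γe ++ Γ') (Δe ++ Δ').
Proof.
move=> nQ Kmono Kinit Kimp Γ Δ; elim=> {Γ Δ}.
- move=> Γ Δ p h1 h2 Γ' Δ' s1 s2 k; have := s2 _ h2; rewrite inE.
  case/orP=> [/eqP e|h]; first exact: Kinit (esym e) (s1 _ h1) k.
  by apply: (@DInit L _ _ p); rewrite mem_cat ?h ?(s1 _ h1) orbT.
- by move=> Γ Δ h1 Γ' Δ' s1 s2 k; apply: DBot; rewrite mem_cat (s1 _ h1) orbT.
- move=> Γ Δ A B h _ IH1 _ IH2 Γ' Δ' s1 s2 k.
  have h' : Imp A B \in Γe ++ Γ' by rewrite mem_cat (s1 _ h) orbT.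
  have d1 : der L (Γe ++ Γ') (Δe ++ A :: Δ').
    by apply: IH1; try (apply: (Kmono _ _ _ _ _ _ k)); sub.
  have d2 : der L (Γe ++ B :: Γ') (Δe ++ Δ').
    by apply: IH2; try (apply: (Kmono _ _ _ _ _ _ k)); sub.
  by apply: (DImpL h'); clear -d1 d2; [weaken d1 | weaken d2].
- move=> Γ Δ A B h _ IH Γ' Δ' s1 s2 k.
  have d : der L (Γe ++ A :: Γ') (Δe ++ B :: Δ').
    by apply: IH; try (apply: (Kmono _ _ _ _ _ _ k)); sub.
  have := s2 _ h; rewrite inE => /orP[/eqP e|h']; first exact: Kimp (esym e) d.
  have h'' : Imp A B \in Δe ++ Δ' by rewrite mem_cat h' orbT.
  by apply: (DImpR h''); clear -d; weaken d.
- move=> Γ Δ o S ok pr sS h1 _ h2 _ Γ' Δ' s1 s2 k.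
  have b1 := @box_sub L _ _ s1; have b2 := @box_sub_nonprec L _ _ _ nQ s2.
  (* A jump keeps at most ≼-formulas of the context and [Q] is not one, so its premisses are reused
     without the induction hypothesis. *)
  have d : der L Γ' Δ'.
    apply: (@DJump L _ _ o S) => //.
    + exact: (principal_sub_nonprec nQ s2 pr).
    + by move=> x /sS /s1.
    + by move=> C D S1 S2 e; apply: (weak (h1 _ _ _ _ e)); clear -b1 b2; sub.
    + by apply: (weak h2); clear -b1 b2; sub.
  by clear -d; weaken d.
- move=> Γ Δ o S ok pr sS h1 _ _ IH2 Γ' Δ' s1 s2 k.
  apply: (@DStay L _ _ o S) => //.
  + by apply: (principal_sub _ (principal_sub_nonprec nQ s2 pr)); clear; sub.
  + by move=> x /sS /s1; rewrite mem_cat orbC => ->.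
  + have : der L (Γe ++ Γ') (Δe ++ (unzip2 S ++ succ_of o ++ Δ')).
      by apply: IH2 => //; [|apply: (Kmono _ _ _ _ _ _ k)]; clear -s2; sub.
    by move=> d; clear -d; weaken d.
- move=> Γ Δ A B c h _ IH1 _ IH2 Γ' Δ' s1 s2 k.
  have h' : A ≼ B \in Γe ++ Γ' by rewrite mem_cat (s1 _ h) orbT.
  have d1 : der L (Γe ++ A :: Γ') (Δe ++ Δ').
    by apply: IH1; try (apply: (Kmono _ _ _ _ _ _ k)); sub.
  have d2 : der L (Γe ++ Γ') (Δe ++ B :: Δ').
    by apply: IH2; try (apply: (Kmono _ _ _ _ _ _ k)); sub.
  by apply: (DC0 c h'); clear -d1 d2; [weaken d1 | weaken d2].
Qed.

(** The counterpart for [Imp A B] on the left: [Himp] replaces the one rule in which it is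
    principal. Taking [A] for [Δe], or [B] for [Γe], yields the two inversions. *)
Lemma replace_left L A B Γe Δe :
  (forall Γ Δ, der L (Γe ++ Γ) (Δe ++ A :: Δ) ->
     der L (Γe ++ B :: Γ) (Δe ++ Δ) -> der L (Γe ++ Γ) (Δe ++ Δ)) ->
  forall Γ Δ, der L Γ Δ -> forall Γ' Δ',
  {subset Γ <= Imp A B :: Γ'} -> {subset Δ <= Δ'} ->
  der L (Γe ++ Γ') (Δe ++ Δ').
Proof.
move=> Himp Γ Δ; elim=> {Γ Δ}.
- move=> Γ Δ p h1 h2 Γ' Δ' s1 s2.
  apply: (@DInit L _ _ p); rewrite mem_cat ?(s2 _ h2) ?orbT //.
  by have := s1 _ h1; rewrite inE /= => ->; rewrite orbT.
- move=> Γ Δ h1 Γ' Δ' s1 s2; apply: DBot; rewrite mem_cat.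
  by have := s1 _ h1; rewrite inE /= => ->; rewrite orbT.
- move=> Γ Δ X Y h _ IH1 _ IH2 Γ' Δ' s1 s2.
  have d1 : der L (Γe ++ Γ') (Δe ++ X :: Δ') by apply: IH1; sub.
  have d2 : der L (Γe ++ Y :: Γ') (Δe ++ Δ') by apply: IH2; sub.
  have := s1 _ h; rewrite inE => /orP[/eqP [eX eY]|h'].
    by apply: Himp; rewrite -?eX -?eY.
  have h'' : Imp X Y \in Γe ++ Γ' by rewrite mem_cat h' orbT.
  by apply: (DImpL h''); clear -d1 d2; [weaken d1 | weaken d2].
- move=> Γ Δ X Y h _ IH Γ' Δ' s1 s2.
  have d : der L (Γe ++ X :: Γ') (Δe ++ Y :: Δ') by apply: IH; sub.
  have h' : Imp X Y \in Δe ++ Δ' by rewrite mem_cat (s2 _ h) orbT.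
  by apply: (DImpR h'); clear -d; weaken d.
- move=> Γ Δ o S ok pr sS h1 _ h2 _ Γ' Δ' s1 s2.
  have b1 : {subset box L Γ <= box L Γ'} by apply: box_sub_nonprec s1.
  have b2 := @box_sub L _ _ s2.
  have d : der L Γ' Δ'.
    apply: (@DJump L _ _ o S) => //.
    + exact: principal_sub pr.
    + by apply: (@sub_sigs_nonprec (Imp A B)) => // x /sS /s1.
    + by move=> C D S1 S2 e; apply: (weak (h1 _ _ _ _ e)); clear -b1 b2; sub.
    + by apply: (weak h2); clear -b1 b2; sub.
  by clear -d; weaken d.
- move=> Γ Δ o S ok pr sS h1 _ _ IH2 Γ' Δ' s1 s2.
  apply: (@DStay L _ _ o S) => //.
  + by apply: (principal_sub _ (principal_sub s2 pr)); clear; sub.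
  + have sS' : {subset sigs S <= Γ'}.
      by apply: (@sub_sigs_nonprec (Imp A B)) => // x /sS /s1.
    by move=> x /sS'; rewrite mem_cat orbC => ->.
  + have : der L (Γe ++ Γ') (Δe ++ (unzip2 S ++ succ_of o ++ Δ')).
      by apply: IH2 => //; clear -s2; sub.
    by move=> d; clear -d; weaken d.
- move=> Γ Δ X Y c h _ IH1 _ IH2 Γ' Δ' s1 s2.
  have d1 : der L (Γe ++ X :: Γ') (Δe ++ Δ') by apply: IH1; sub.
  have d2 : der L (Γe ++ Γ') (Δe ++ Y :: Δ') by apply: IH2; sub.
  have h' : X ≼ Y \in Γe ++ Γ'.
    by have := s1 _ h; rewrite inE mem_cat /= => ->; rewrite orbT.
  by apply: (DC0 c h'); clear -d1 d2; [weaken d1 | weaken d2].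
Qed.

(** * Cut on atoms, falsity and implications *)

Definition cut_for L (P : form) : Prop :=
  forall Γ Δ, der L Γ (P :: Δ) -> der L (P :: Γ) Δ -> der L Γ Δ.

(** At an initial sequent on [p] the antecedent contains [p], and there the other premiss, recorded
    by [K], is the desired sequent up to contraction. *)
Lemma cut_atom L p : cut_for L (Atom p).
Proof.
move=> Γ Δ d1 d2.
pose K Γ Δ := der L (Atom p :: Γ) Δ.
have := @replace_right L (Atom p) [::] [::] K isT _ _ _ _ _ d1 Γ Δ.
apply=> // [Γ1 Δ1 Γ2 Δ2 s1 s2 k|q Γ1 Δ1 [<-] h k]; first by weaken k.
by apply: (weak k) => // x; rewrite inE => /orP[/eqP ->|].
Qed.

(** No rule has [Bot] principal on the right, so it can be deleted from the succedents
    throughout. *)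
Lemma cut_bot L : cut_for L Bot.
Proof.
move=> Γ Δ d1 _.
by have := @replace_right L Bot [::] [::] (fun _ _ => True) isT _ _ _ _ _ d1 Γ Δ;
   apply.
Qed.

Lemma inv_impR L A B Γ Δ :
  der L Γ (Imp A B :: Δ) -> der L (A :: Γ) (B :: Δ).
Proof.
move=> d.
have := @replace_right L (Imp A B) [:: A] [:: B] (fun _ _ => True) isT _ _ _ _ _
  d Γ Δ.
by apply=> // X Y Γ1 Δ1 [<- <-] k; weaken k.
Qed.

Lemma inv_impL1 L A B Γ Δ : der L (Imp A B :: Γ) Δ -> der L Γ (A :: Δ).
Proof.
move=> d; have := @replace_left L A B [::] [:: A] _ _ _ d Γ Δ.
by apply=> // Γ1 Δ1 k _; weaken k.
Qed.

Lemma inv_impL2 L A B Γ Δ : der L (Imp A B :: Γ) Δ -> der L (B :: Γ) Δ.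
Proof.
move=> d; have := @replace_left L A B [:: B] [::] _ _ _ d Γ Δ.
by apply=> // Γ1 Δ1 _ k; weaken k.
Qed.

Lemma cut_imp L A B : cut_for L A -> cut_for L B -> cut_for L (Imp A B).
Proof.
move=> cA cB Γ Δ /inv_impR d1 d2.
have dA := inv_impL1 d2; have dB := inv_impL2 d2.
apply: cB => //; apply: cA; last by [].
by weaken dA.
Qed.

(** The shared contexts of [cut_for] are no restriction: both premisses are first weakened to the
    target contexts. *)
Lemma cut_sub L P Γ1 Δ1 Γ2 Δ2 Γ Δ : cut_for L P ->
  der L Γ1 Δ1 -> der L Γ2 Δ2 ->
  {subset Γ1 <= Γ} -> {subset Δ1 <= P :: Δ} ->
  {subset Γ2 <= P :: Γ} -> {subset Δ2 <= Δ} -> der L Γ Δ.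
Proof.
by move=> c d1 d2 s1 s2 s3 s4; apply: c; [apply: (weak d1) | apply: (weak d2)].
Qed.

(** * Blocks and their splicing *)

Lemma chained_nil L Γ Δ : chained L Γ Δ [::].
Proof. by move=> C D S1 [|? ?]. Qed.

Lemma chained_cons L Γ Δ C D S :
  chained L Γ Δ ((C, D) :: S) <->
  der L (C :: Γ) (unzip2 S ++ Δ) /\ chained L Γ Δ S.
Proof.
split=> [h|[d h] C' D' S1 [|q S2]].
- split; first exact: (h C D S [::]).
  by move=> C' D' S1 S2 e; apply: (h C' D' S1 ((C, D) :: S2)); rewrite e.
- by case=> <- _ <-.
- by case=> _; apply: h.
Qed.

(** The pairs of [T] get the smaller indices, so their second components are available on the right
    in the premisses of [S]. *)
Lemma chained_cat L Γ Δ S T : chained L Γ (unzip2 T ++ Δ) S ->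
  chained L Γ Δ T -> chained L Γ Δ (S ++ T).
Proof.
elim: S => [//|[C D] S IH] /chained_cons[d /IH h] /h h'.
by apply/chained_cons; split=> //; rewrite /unzip2 map_cat -catA.
Qed.

Lemma chained_impl L Γ Δ Γ' Δ' S :
  (forall C (S1 : block), der L (C :: Γ) (unzip2 S1 ++ Δ) ->
     der L (C :: Γ') (unzip2 S1 ++ Δ')) ->
  chained L Γ Δ S -> chained L Γ' Δ' S.
Proof. by move=> f h C D S1 S2 e; apply/f/(h _ _ _ _ e). Qed.

(** The pairs are removed from the last to the first: the indexed premiss of [C ≼ D] is the left
    premiss of C_0, and the sequent with [D] still on the right is the other. *)
Lemma chained_C0 L Γ Δ S : has_C L -> {subset sigs S <= Γ} ->
  chained L Γ Δ S -> der L Γ (unzip2 S ++ Δ) -> der L Γ Δ.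
Proof.
move=> c; elim: S => [//|[C D] S IH] sS /chained_cons[d h] d'.
apply: IH => //; first by move=> x hx; apply: sS; rewrite inE hx orbT.
by apply: (@DC0 L _ _ C D) => //; apply: sS; rewrite inE eqxx.
Qed.

(* Each use of [A ≼ B] in the block [S'] is replaced by the whole block [S],
   cutting on [A]; the occurrences of [B] are then cut away at the end. *)
Lemma splice_block L A B Γc Δ0 Δc S S' Γ : cut_for L A -> cut_for L B ->
  chained L Γc (A :: Δ0) S -> der L (B :: Γc) (unzip2 S ++ A :: Δ0) ->
  {subset Δ0 <= Δc} -> {subset sigs S <= Γ} ->
  chained L Γc Δc S' -> {subset sigs S' <= A ≼ B :: Γ} ->
  exists S'', [/\ {subset sigs S'' <= Γ}, chained L Γc Δc S''
    & forall Γ1 Δ1, {subset Γc <= Γ1} -> {subset Δc <= Δ1} ->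
      der L Γ1 (unzip2 S' ++ Δ1) -> der L Γ1 (unzip2 S'' ++ Δ1)].
Proof.
move=> cA cB hS dB s0 sS; elim: S' => [|[E F] T IH].
  by move=> _ _; exists [::]; split=> //; apply: chained_nil.
move=> /chained_cons[d hT] sT.
have sT' : {subset sigs T <= A ≼ B :: Γ}.
  by move=> x hx; apply: sT; rewrite inE hx orbT.
have [T' [sT'' hT' f]] := IH hT sT'.
(* Here [f] is used with [E] on the left; below it is used with [B] or [F] on the right. This is why
   its contexts [Γ1] and [Δ1] are arbitrary. *)
have d' : der L (E :: Γc) (unzip2 T' ++ Δc) by apply: f d => //; clear; sub.
have := sT (E ≼ F); rewrite !inE eqxx => /(_ isT) /orP[/eqP [eE eF]|hEF].
- subst E F; exists (S ++ T'); split.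
  + by rewrite /sigs map_cat => x; rewrite mem_cat => /orP[/sS|/sT''].
  (* With [E] equal to [A], the premiss [d'] has [A] on the left and is cut against the [A] in each
     succedent of the chain of [S]. *)
  + apply: chained_cat => //; apply: chained_impl hS => C S1 dC.
    by apply: (cut_sub cA dC d'); clear -s0; sub.
  + move=> Γ1 Δ1 s1 s2 dT.
    have d1 : der L Γ1 (unzip2 T' ++ B :: Δ1).
      apply: f => //; first by clear -s2; sub.
      by clear -dT; weaken dT.
    have d2 : der L (B :: Γ1) (unzip2 S ++ unzip2 T' ++ Δ1).
      by apply: (cut_sub cA dB d'); clear -s0 s1 s2; sub.
    rewrite /unzip2 map_cat.
    by apply: (cut_sub cB d1 d2); clear; rewrite /unzip2; sub.
- exists ((E, F) :: T'); split; first 1 last.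
  + exact/chained_cons.
  + move=> Γ1 Δ1 s1 s2 dT.
    have d1 : der L Γ1 (unzip2 T' ++ F :: Δ1).
      apply: f => //; first by clear -s2; sub.
      by clear -dT; weaken dT.
    by clear -d1; weaken d1.
  + by move=> x; rewrite inE => /orP[/eqP ->|/sT''].
Qed.

(* [S1] is the part of [S] that precedes the first use of [A ≼ B]. *)
Lemma first_use L A B Γc Δc S Γ :
  chained L Γc Δc S -> {subset sigs S <= A ≼ B :: Γ} ->
  {subset sigs S <= Γ} \/
  exists S1, [/\ {subset sigs S1 <= Γ}, chained L Γc Δc S1
               & der L (A :: Γc) (unzip2 S1 ++ Δc)].
Proof.
elim: S => [|[E F] T IH]; first by left.
move=> /chained_cons[d hT] sT.
have sT' : {subset sigs T <= A ≼ B :: Γ}.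
  by move=> x hx; apply: sT; rewrite inE hx orbT.
have [sT''|] := IH hT sT'; last by right.
have := sT (E ≼ F); rewrite !inE eqxx => /(_ isT) /orP[/eqP [eE eF]|hEF].
  by right; exists T; split; rewrite -?eE.
by left=> x; rewrite inE => /orP[/eqP ->|/sT''].
Qed.

(** * Cut on ≼-formulas *)

Lemma sigs_box L S Γ :
  is_abs L -> {subset sigs S <= Γ} -> {subset sigs S <= box L Γ}.
Proof.
rewrite /box => -> h x hx; rewrite mem_filter h // andbT.
by case/mapP: hx => q _ ->.
Qed.

Lemma principal_box L o Δ : is_abs L -> principal o Δ -> principal o (box L Δ).
Proof. by rewrite /box => ->; case: o => [[A B]|] //=; rewrite mem_filter. Qed.

(* Induction on the derivation in which the cut formula [P] is on the left;
   [K] is what the other derivation says about the context. *)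
Lemma cut_left_ind L P (K : seq form -> seq form -> Prop) :
  is_prec P ->
  (forall Γ Δ Γ' Δ', {subset Γ <= Γ'} -> {subset Δ <= Δ'} ->
     K Γ Δ -> K Γ' Δ') ->
  (is_abs L -> forall Γ Δ, K Γ Δ -> K (box L Γ) (box L Δ)) ->
  (forall A B Γ Δ, has_C L -> P = A ≼ B -> K Γ Δ ->
     der L (A :: Γ) Δ -> der L Γ (B :: Δ) -> der L Γ Δ) ->
  (forall o S Γ Δ, stay_ok L o -> principal o Δ ->
     {subset sigs S <= P :: Γ} -> chained L [::] (succ_of o) S ->
     der L Γ (unzip2 S ++ succ_of o ++ Δ) -> K Γ Δ -> der L Γ Δ) ->
  (forall o S Γ Δ, jump_ok L o -> principal o Δ ->
     {subset sigs S <= P :: Γ} ->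
     chained L (box L Γ) (succ_of o ++ box L Δ) S ->
     der L (ante_of o ++ box L Γ) (unzip2 S ++ succ_of o ++ box L Δ) ->
     (is_abs L -> der L (P :: box L Γ) (box L Δ)) -> K Γ Δ -> der L Γ Δ) ->
  forall Γ Δ, der L Γ Δ -> forall Γ' Δ',
  {subset Γ <= P :: Γ'} -> {subset Δ <= Δ'} -> K Γ' Δ' -> der L Γ' Δ'.
Proof.
move=> pP Kmono Kbox KC0 Kstay Kjump Γ Δ; elim=> {Γ Δ}.
- move=> Γ Δ p h1 h2 Γ' Δ' s1 s2 _; apply: (@DInit L _ _ p); last exact: s2.
  by have := s1 _ h1; rewrite inE => /orP[/eqP e|//]; rewrite -e in pP.
- move=> Γ Δ h1 Γ' Δ' s1 s2 _; apply: DBot.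
  by have := s1 _ h1; rewrite inE => /orP[/eqP e|//]; rewrite -e in pP.
- move=> Γ Δ A B h _ IH1 _ IH2 Γ' Δ' s1 s2 k.
  have h' : Imp A B \in Γ'.
    by have := s1 _ h; rewrite inE => /orP[/eqP e|//]; rewrite -e in pP.
  by apply: (DImpL h'); [apply: IH1 | apply: IH2];
     try (apply: (Kmono _ _ _ _ _ _ k)); sub.
- move=> Γ Δ A B h _ IH Γ' Δ' s1 s2 k.
  by apply: (DImpR (s2 _ h)); apply: IH; try (apply: (Kmono _ _ _ _ _ _ k)); sub.
- move=> Γ Δ o S ok pr sS h1 IH1 h2 IH2 Γ' Δ' s1 s2 k.
  have b1 := @box_sub_cons L _ _ _ s1; have b2 := @box_sub L _ _ s2.
  have pr' := principal_sub s2 pr.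
  have sS' : {subset sigs S <= P :: Γ'} by move=> x /sS /s1.
  (* As [box] is idempotent, the jump can be repeated on the boxed context. The result serves to cut
     [P] inside the premisses of a rule of the other derivation. *)
  have restr : is_abs L -> der L (P :: box L Γ') (box L Δ').
    move=> ab; have b3 := @box_sub L _ _ b1; have b4 := @box_sub L _ _ b2.
    rewrite !box_idem in b3 b4.
    apply: (@DJump L _ _ o S) => //.
    + exact: principal_box.
    + by move=> x /(sigs_box ab sS) /b1.
    + by move=> C D S1 S2 e; apply: (weak (h1 _ _ _ _ e)); clear -b3 b4;
         rewrite ?box_idem; sub.
    + by apply: (weak h2); clear -b3 b4; rewrite ?box_idem; sub.
  apply: (Kjump o S) => //.
  (* With [is_abs], [P] may survive in the premisses and is cut by induction; otherwise [box] is
     empty and [P] is gone. *)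
  + move=> C D S1 S2 e; have [ab|nab] := boolP (is_abs L).
      apply: (IH1 _ _ _ _ e); [clear -b1; sub | clear -b2; sub | ].
      by apply: (Kmono _ _ _ _ _ _ (Kbox ab _ _ k)); clear; sub.
    by have := h1 _ _ _ _ e; rewrite /box (negbTE nab).
  + have [ab|nab] := boolP (is_abs L).
      apply: IH2; [clear -b1; sub | clear -b2; sub | ].
      by apply: (Kmono _ _ _ _ _ _ (Kbox ab _ _ k)); clear; sub.
    by move: h2; rewrite /box (negbTE nab).
- move=> Γ Δ o S ok pr sS h1 _ _ IH2 Γ' Δ' s1 s2 k.
  apply: (Kstay o S) => //.
  + exact: principal_sub s2 pr.
  + by move=> x /sS /s1.
  + by apply: IH2 => //; [|apply: (Kmono _ _ _ _ _ _ k) => //]; clear -s2; sub.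
- move=> Γ Δ A B c h _ IH1 _ IH2 Γ' Δ' s1 s2 k.
  have d1 : der L (A :: Γ') Δ'.
    by apply: IH1; try (apply: (Kmono _ _ _ _ _ _ k)); sub.
  have d2 : der L Γ' (B :: Δ').
    by apply: IH2; try (apply: (Kmono _ _ _ _ _ _ k)); sub.
  have := s1 _ h; rewrite inE => /orP[/eqP e|h']; last exact: (DC0 c h').
  exact: (KC0 A B).
Qed.

(** The outer induction is on the derivation with [A ≼ B] on the right, the inner one on the other.
    If a jump introduces [A ≼ B], its block is spliced into every use on the left. If W does, its
    last premiss offers [A] in the whole context, so a cut on [A] at the first use is enough. *)
Lemma cut_prec L A B : cut_for L A -> cut_for L B -> cut_for L (A ≼ B).
Proof.
move=> cA cB.
suff main Γ1 Δ1 : der L Γ1 Δ1 -> forall Γ Δ, {subset Γ1 <= Γ} ->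
    {subset Δ1 <= A ≼ B :: Δ} -> der L (A ≼ B :: Γ) Δ -> der L Γ Δ.
  by move=> Γ Δ /main d1 d2; apply: d1.
elim=> {Γ1 Δ1}.
- move=> Γ1 Δ1 p h1 h2 Γ Δ s1 s2 _; apply: (@DInit L _ _ p); first exact: s1.
  by have := s2 _ h2; rewrite inE.
- by move=> Γ1 Δ1 h1 Γ Δ s1 s2 _; apply: DBot; apply: s1.
- move=> Γ1 Δ1 X Y h _ IH1 _ IH2 Γ Δ s1 s2 d2.
  by apply: (DImpL (s1 _ h)); [apply: IH1 | apply: IH2];
     try (apply: (weak d2)); sub.
- move=> Γ1 Δ1 X Y h _ IH Γ Δ s1 s2 d2.
  have h' : Imp X Y \in Δ by have := s2 _ h; rewrite inE.
  by apply: (DImpR h'); apply: IH; try (apply: (weak d2)); sub.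
- move=> Γ1 Δ1 o S ok pr sS h1 IH1 h2 IH2 Γ Δ s1 s2 d2.
  (* [K] states that the right rule still applies, up to a cut of [A ≼ B] in its premisses, after
     the inner induction has enlarged the context. *)
  pose K Γ Δ := [/\ {subset box L Γ1 <= box L Γ},
    {subset box L Δ1 <= A ≼ B :: box L Δ} & {subset sigs S <= Γ}].
  have Kmono Γa Δa Γb Δb : {subset Γa <= Γb} -> {subset Δa <= Δb} ->
      K Γa Δa -> K Γb Δb.
    move=> /[dup] sa /(@box_sub L) ba /(@box_sub L) bb [k1 k2 k3].
    by split; [clear -k1 ba; sub | clear -k2 bb; sub | clear -k3 sa; sub].
  have Kbox : is_abs L -> forall Γ Δ, K Γ Δ -> K (box L Γ) (box L Δ).
    by move=> ab Γa Δa [k1 k2 k3]; split; rewrite ?box_idem //; apply: sigs_box.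
  have k0 : K Γ Δ.
    by split; [apply: box_sub | apply: box_sub_cons | move=> x /sS /s1].
  (* the premisses of the right rule, with [A ≼ B] cut from their succedents *)
  have prem Γa Δa : (is_abs L -> der L (A ≼ B :: box L Γa) (box L Δa)) ->
      K Γa Δa -> chained L (box L Γa) (succ_of o ++ box L Δa) S /\
        der L (ante_of o ++ box L Γa) (unzip2 S ++ succ_of o ++ box L Δa).
    move=> d [k1 k2 _]; have [ab|nab] := boolP (is_abs L); last first.
      move: h1 h2; rewrite /box (negbTE nab) => h1 h2; split=> //.
    have {}d := d ab; split=> [C D S1 S2 e|].
      apply: (IH1 _ _ _ _ e); [clear -k1; sub | clear -k2; sub | ].
      by clear -d; weaken d.
    apply: IH2; [clear -k1; sub | clear -k2; sub | ].
    by clear -d; weaken d.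
  case: (principal_sub_cons s2 pr) => [pr'|[A' [B' [eo [eA eB]]]]].
    have [ab|nab] := boolP (is_abs L); last first.
      apply: (@DJump L _ _ o S) => //; first by move=> x /sS /s1.
      + by move: h1; rewrite /box (negbTE nab).
      + by move: h2; rewrite /box (negbTE nab).
    (* Here [A ≼ B] is a side formula that may survive in the boxed succedents. Cutting it there
       takes a boxed version of [d2], which exists at the jumps of [d2]: the inner induction
       descends to them and then applies the right rule. *)
    pose K' Γ Δ := K Γ Δ /\ principal o Δ.
    have s3 : {subset A ≼ B :: Γ <= A ≼ B :: Γ} by [].
    have s4 : {subset Δ <= Δ} by [].
    apply: (@cut_left_ind L (A ≼ B) K' _ _ _ _ _ _ _ _ d2 _ _ s3 s4) => //.
    + move=> Γa Δa Γb Δb sa sb [k kp].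
      by split; [apply: Kmono k | apply: principal_sub kp].
    + by move=> _ Γa Δa [k kp]; split; [apply: Kbox | apply: principal_box].
    + by move=> X Y Γa Δa; move: ab; case: (L).
    + by move=> [[X Y]|] T Γa Δa; move: ab; case: (L).
    + move=> o' S' Γa Δa _ _ _ _ _ restr [k kp].
      have [p1 p2] := prem _ _ restr k.
      by apply: (@DJump L _ _ o S) => //; case: k.
  subst o A' B'.
  have s3 : {subset A ≼ B :: Γ <= A ≼ B :: Γ} by [].
  have s4 : {subset Δ <= Δ} by [].
  apply: (@cut_left_ind L (A ≼ B) K _ _ _ _ _ _ _ _ d2 _ _ s3 s4) => //.
  + move=> _ _ Γa Δa c [<- <-] k dA dB.
    have nab : is_abs L = false by move: c; case: (L).
    move: h1 h2; rewrite /box nab /= => h1 h2; case: k => _ _ k.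
    (* C_0 on [A ≼ B] becomes a series of C_0 on the pairs of [S], with premisses obtained by cuts
       on [A] and [B]. *)
    apply: (chained_C0 c k).
      move=> C D S1 S2 e; have d := h1 _ _ _ _ e.
      by apply: (cut_sub cA d dA); clear; sub.
    have d : der L Γa (A :: unzip2 S ++ Δa).
      by apply: (cut_sub cB dB h2); clear; sub.
    by apply: (cut_sub cA d dA); clear; sub.
  + move=> o' S' Γa Δa ok' pr' sS' hS' d k.
    have nab : is_abs L = false.
      by move: ok'; case: o' {pr' hS' d} => [?|]; case: (L).
    move: h1 h2; rewrite /box nab /= => h1 h2; case: k => _ _ k.
    have s0 : {subset [::] <= succ_of o'} by [].
    have [S'' [sS'' hS'' f]] := splice_block cA cB h1 h2 s0 k hS' sS'.
    apply: (@DStay L _ _ o' S'') => //; apply: f d => //.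
    by clear; sub.
  + move=> o' S' Γa Δa ok' pr' sS' hS' d restr k.
    have [p1 p2] := prem _ _ restr k; case: k => _ _ k.
    have s0 : {subset box L Δa <= succ_of o' ++ box L Δa} by clear; sub.
    have [S'' [sS'' hS'' f]] := splice_block cA cB p1 p2 s0 k hS' sS'.
    apply: (@DJump L _ _ o' S'') => //; apply: f d => //.
    by clear; sub.
- move=> Γ1 Δ1 o S ok pr sS h1 _ _ IH Γ Δ s1 s2 d2.
  have sS' : {subset sigs S <= Γ} by move=> x /sS /s1.
  (* The last premiss keeps the whole succedent, hence possibly [A ≼ B], which the induction
     hypothesis cuts away. *)
  have d1 : der L Γ (unzip2 S ++ succ_of o ++ Δ).
    apply: IH => //; first by clear -s2; sub.
    by clear -d2; weaken d2.
  case: (principal_sub_cons s2 pr) => [pr'|[A' [B' [eo [eA eB]]]]].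
    exact: (@DStay L _ _ o S).
  subst o A' B'.
  have nab : is_abs L = false by move: ok; case: (L).
  pose K (Γ' Δ' : seq form) := {subset Γ <= Γ'} /\ {subset Δ <= Δ'}.
  have s3 : {subset A ≼ B :: Γ <= A ≼ B :: Γ} by [].
  have s4 : {subset Δ <= Δ} by [].
  apply: (@cut_left_ind L (A ≼ B) K _ _ _ _ _ _ _ _ d2 _ _ s3 s4) => //.
  + by move=> Γa Δa Γb Δb sa sb [k1 k2]; split; sub.
  + by rewrite nab.
  + move=> _ _ Γa Δa c [<- <-] [k1 k2] dA dB.
    apply: (chained_C0 c) => [x /sS' /k1 //| |].
      move=> C D S1 S2 e; have d := h1 _ _ _ _ e.
      by apply: (cut_sub cA d dA); clear; sub.
    by apply: (cut_sub cA d1 dA); clear -k1 k2; sub.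
  + move=> o' S' Γa Δa ok' pr' sT hS' d [k1 k2].
    case: (first_use hS' sT) => [sT'|[S1 [sS1 hS1 dA]]].
      exact: (@DStay L _ _ o' S').
    (* [S1] precedes [S] in index order: cutting [A] against [dA] puts the second components of [S1]
       into the premisses of [S]. *)
    apply: (@DStay L _ _ o' (S ++ S1)) => //.
    * rewrite /sigs map_cat => x; rewrite mem_cat.
      by case/orP=> [/sS' /k1|/sS1].
    * apply: chained_cat hS1; apply: chained_impl h1 => C T dC.
      by apply: (cut_sub cA dC dA); clear; sub.
    * rewrite /unzip2 map_cat.
      by apply: (cut_sub cA d1 dA); rewrite /unzip2; clear -k1 k2; sub.
  + move=> o' S' Γa Δa ok' pr'; rewrite /box nab !cats0.
    move=> sT hS' d _ [k1 k2].
    case: (first_use hS' sT) => [sT'|[S1 [sS1 hS1 dA]]].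
      by apply: (@DJump L _ _ o' S'); rewrite /box ?nab ?cats0.
    (* The cut with [d1] needs the whole context, so the jump turns into a stay. A calculus with W
       has no N-rule, so [o'] is a [Some] and the result is an instance of W. *)
    apply: (@DStay L _ _ o' (S ++ S1)) => //.
    * by move: ok ok'; rewrite /stay_ok /jump_ok; clear; case: o' => [?|]; case: L.
    * rewrite /sigs map_cat => x; rewrite mem_cat.
      by case/orP=> [/sS' /k1|/sS1].
    * apply: chained_cat hS1; apply: chained_impl h1 => C T dC.
      by apply: (cut_sub cA dC dA); clear; sub.
    * rewrite /unzip2 map_cat.
      by apply: (cut_sub cA d1 dA); rewrite /unzip2; clear -k1 k2; sub.
  + by split.
- move=> Γ1 Δ1 X Y c h _ IH1 _ IH2 Γ Δ s1 s2 d2.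
  by apply: (DC0 c (s1 _ h)); [apply: IH1 | apply: IH2];
     try (apply: (weak d2)); sub.
Qed.

Lemma cut_der L P : cut_for L P.
Proof.
elim: P => [p||A cA B cB|A cA B cB].
- exact: cut_atom.
- exact: cut_bot.
- exact: cut_imp.
- exact: cut_prec.
Qed.

(** * From derivations on multisets to derivations on sets *)

Lemma mem_enum_mset (A : ctx) x : (x \in enum_mset A) = (x \in A).
Proof. by []. Qed.

Lemma mem_seq_mset (s : seq form) x : (x \in seq_mset s) = (x \in s).
Proof. by rewrite in_mset mset_seqE -has_count has_pred1. Qed.

Lemma mem_precs (Γ : ctx) x : (x \in precs Γ) = is_prec x && (x \in Γ).
Proof. by rewrite mem_seq_mset mem_filter mem_enum_mset. Qed.

Lemma mem_sigs_rev S x : (x \in sigs (rev S)) = (x \in sigs S).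
Proof. by rewrite /sigs map_rev mem_rev. Qed.

Lemma mem_unzip2_rev (S : block) x : (x \in unzip2 (rev S)) = (x \in unzip2 S).
Proof. by rewrite /unzip2 map_rev mem_rev. Qed.

Lemma mem_Sig S x : (x \in Sig S) = (x \in sigs S).
Proof. exact: mem_seq_mset. Qed.

Lemma Ds_size S n : size S = n -> Ds S n = seq_mset (unzip2 S).
Proof. by move=> <-; rewrite /Ds take_oversize // size_map. Qed.

(** Trades the index of a premiss for a splitting of the block, the form used by [chained]. *)
Lemma mem_chain Γ Δ S s : s \in chain Γ Δ S <->
  exists C D S1 S2, S = S1 ++ (C, D) :: S2 /\
    s = (C +` Γ ⇒ Δ `+` seq_mset (unzip2 S1)).
Proof.
split=> [/mapP[k]|[C [D [S1 [S2 [-> ->]]]]]].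
  rewrite mem_iota add0n => /= hk ->.
  case e: (nth (Bot, Bot) S k) => [C D]; exists C, D, (take k S), (drop k.+1 S).
  rewrite -e -drop_nth // cat_take_drop; split=> //.
  by rewrite /Ds /unzip2 map_take e.
apply/mapP; exists (size S1).
  by rewrite mem_iota size_cat /= add0n addnS leq_addr.
rewrite nth_cat ltnn subnn /= /Ds /unzip2 map_cat take_size_cat ?size_map //.
Qed.

Ltac msub :=
  let x := fresh "x" in
  move=> x;
  repeat match goal with
  | H : {subset _ <= _} |- _ => move: (H x); clear H
  end;
  rewrite ?(inE, in_msetE, mem_cat, in_nil, mem_enum_mset, mem_seq_mset, mem_Sig,
            mem_precs, mem_sigs_rev, mem_unzip2_rev, mem_filter);
  try by [bool_cases].

Definition der_seq L (s : sequent) : Prop := der L s.1 s.2.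

Definition preserves (P : sequent -> Prop) (r : rule) : Prop :=
  forall ps c, r ps c -> (forall s, s \in ps -> P s) -> P c.

Lemma preserves_union P r1 r2 :
  preserves P r1 -> preserves P r2 -> preserves P (r1 ∪ r2).
Proof. by move=> h1 h2 ps c [/h1|/h2]; apply. Qed.

Lemma preserves_family P m r :
  (forall n, m <= n -> preserves P (r n)) -> preserves P (rfamily m r).
Proof. by move=> h ps c [n hn /(h n hn)]; apply. Qed.

Lemma der_prop L : preserves (der_seq L) G_prop.
Proof.
move=> ps c [[[[Γ Δ p]|[Γ Δ]]|[Γ Δ A B]]|[Γ Δ A B]] h; rewrite /der_seq /=.
- by apply: (@DInit L _ _ p); rewrite mem_enum_mset !in_msetE eqxx.
- by apply: DBot; rewrite mem_enum_mset !in_msetE eqxx.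
- have d1 := h _ (mem_head _ _); have d2 := h (_, _) (mem_last _ [:: _]).
  apply: (@DImpL L _ _ A B); first by rewrite mem_enum_mset !in_msetE eqxx.
    by apply: (weak d1) => /=; clear; msub.
  by apply: (weak d2) => /=; clear; msub.
- have d1 := h _ (mem_head _ _).
  apply: (@DImpR L _ _ A B); first by rewrite mem_enum_mset !in_msetE eqxx.
  by apply: (weak d1) => /=; clear; msub.
Qed.

Lemma chained_of_chain L Γm Δm S Γ Δ :
  (forall s, s \in chain Γm Δm S -> der_seq L s) ->
  {subset Γm <= Γ} -> {subset Δm <= Δ} -> chained L Γ Δ (rev S).
Proof.
move=> h s1 s2 C D S1 S2 e.
have eS : S = rev S1 ++ (C, D) :: rev S2.
  by rewrite -[S]revK e rev_cat rev_cons cat_rcons.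
have /h d : (C +` Γm ⇒ Δm `+` seq_mset (unzip2 (rev S1))) \in chain Γm Δm S.
  by apply/mem_chain; exists C, D, (rev S1), (rev S2).
by apply: (weak d) => /=; clear -s1 s2; msub.
Qed.

Lemma premises_rcons (P : sequent -> Prop) (ps : seq sequent) (p : sequent) :
  (forall s, s \in rcons ps p -> P s) -> (forall s, s \in ps -> P s) /\ P p.
Proof.
move=> h; split=> [s hs|]; apply: h; rewrite mem_rcons inE ?eqxx //.
by rewrite hs orbT.
Qed.

Lemma der_CP L n : is_abs L = false -> preserves (der_seq L) (CP_rule n).
Proof.
move=> nab _ _ [Γ Δ A B S en] /premises_rcons[hc d].
apply: (@DJump L _ _ (Some (A, B)) (rev S)) => //=.
- by rewrite mem_enum_mset !in_msetE eqxx.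
- by clear; msub.
- by apply: (chained_of_chain hc); clear; msub.
- by apply: (weak d); rewrite /= ?(Ds_size en); clear; msub.
Qed.

Lemma der_N L n : is_abs L = false -> has_N L -> preserves (der_seq L) (N_rule n).
Proof.
move=> nab hN _ _ [Γ Δ S en] /premises_rcons[hc d].
apply: (@DJump L _ _ None (rev S)) => //=.
- by clear; msub.
- by apply: (chained_of_chain hc); clear; msub.
- by apply: (weak d); rewrite /= ?(Ds_size en); clear; msub.
Qed.

Lemma der_T L n : has_T L -> preserves (der_seq L) (T_rule n).
Proof.
move=> hT _ _ [Γ Δ S en] /premises_rcons[hc d].
apply: (@DStay L _ _ None (rev S)) => //=.
- by clear; msub.
- by apply: (chained_of_chain hc); clear; msub.
- by apply: (weak d); rewrite /= ?(Ds_size en); clear; msub.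
Qed.

Lemma der_W L n : has_W L -> preserves (der_seq L) (W_rule n).
Proof.
move=> hW _ _ [Γ Δ A B S en] /premises_rcons[hc d].
apply: (@DStay L _ _ (Some (A, B)) (rev S)) => //=.
- by rewrite mem_enum_mset !in_msetE eqxx.
- by clear; msub.
- by apply: (chained_of_chain hc); clear; msub.
- by apply: (weak d); rewrite /= ?(Ds_size en); clear; msub.
Qed.

Lemma der_C0 L : has_C L -> preserves (der_seq L) C0_rule.
Proof.
move=> hC _ _ [Γ Δ A B] h.
have d1 := h _ (mem_head _ _); have d2 := h (_, _) (mem_last _ [:: _]).
apply: (@DC0 L _ _ A B) => //=; first by rewrite mem_enum_mset !in_msetE eqxx.
  by apply: (weak d1) => /=; clear; msub.
by apply: (weak d2) => /=; clear; msub.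
Qed.

Lemma mem_box_abs L Γ x :
  is_abs L -> (x \in box L Γ) = is_prec x && (x \in Γ).
Proof. by rewrite /box => ->; rewrite mem_filter. Qed.

Lemma is_prec_sigs S x : x \in sigs S -> is_prec x.
Proof. by case/mapP=> q _ ->. Qed.

Lemma precs_Sig_sub_box L Γ S : is_abs L ->
  {subset precs Γ `+` Sig S <= box L (Γ `+` Sig S)}.
Proof.
move=> ab x; rewrite mem_box_abs // mem_enum_mset !in_msetD mem_precs mem_Sig.
by case/orP=> [/andP[-> ->]//|h]; rewrite h orbT (is_prec_sigs h).
Qed.

Lemma der_A L n : is_abs L -> preserves (der_seq L) (A_rule n).
Proof.
move=> ab _ _ [Γ Δ A B S en] /premises_rcons[hc d].
have s1 := @precs_Sig_sub_box L Γ S ab.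
(* The principal formula is itself a ≼-formula of the conclusion, hence lies in [box]; only [A]
   comes from [succ_of]. *)
have s2 : {subset [mset A ≼ B; A] `+` precs Δ <= A :: box L (A ≼ B +` Δ)}.
  move=> x; rewrite inE mem_box_abs // mem_enum_mset !in_msetE mem_precs /=.
  by case/orP=> [/orP[/eqP ->|->]|/andP[-> ->]] //; rewrite ?eqxx ?orbT.
apply: (@DJump L _ _ (Some (A, B)) (rev S)) => //=.
- by rewrite mem_enum_mset !in_msetE eqxx.
- by clear; msub.
- exact: (chained_of_chain hc).
- apply: (weak d) => /=.
    by move=> x; rewrite mem_enum_mset in_msetD in_msetn inE /= => /orP[->|/s1 ->];
       rewrite ?orbT.
  move=> x; rewrite mem_enum_mset in_msetD (Ds_size en).
  rewrite [x \in seq_mset (unzip2 _)]mem_seq_mset mem_cat mem_unzip2_rev.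
  by case/orP=> [/s2 ->|->]; rewrite ?orbT.
Qed.

Lemma der_NA L n : is_abs L -> has_N L -> preserves (der_seq L) (NA_rule n).
Proof.
move=> ab hN _ _ [Γ Δ S en] /premises_rcons[hc d].
have s1 := @precs_Sig_sub_box L Γ S ab.
have s2 : {subset precs Δ <= box L Δ}.
  by move=> x; rewrite mem_box_abs // mem_precs.
apply: (@DJump L _ _ None (rev S)) => //=.
- by clear; msub.
- exact: (chained_of_chain hc).
- apply: (weak d) => //= x.
  rewrite mem_enum_mset in_msetD (Ds_size en).
  rewrite [x \in seq_mset (unzip2 _)]mem_seq_mset mem_cat mem_unzip2_rev.
  by case/orP=> [/s2 ->|->]; rewrite ?orbT.
Qed.

Lemma der_rules L : preserves (der_seq L) (rules L).
Proof.
have hp := @der_prop L.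
have hCP : is_abs L = false -> preserves (der_seq L) (rfamily 0 CP_rule).
  by move=> nab; apply: preserves_family => n _; apply: der_CP.
case: L hp hCP => hp hCP /=; repeat apply: preserves_union => //;
  try exact: hCP; try (apply: preserves_family => n _).
- exact: der_N.
- exact: der_T.
- exact: der_W.
- exact: der_T.
- exact: der_W.
- exact: der_C0.
- exact: der_A.
- exact: der_A.
- exact: der_NA.
Qed.

Lemma der_of_derivable L s : derivable (rules L) s -> der_seq L s.
Proof. by elim=> ps c r _ IH; apply: der_rules r IH. Qed.

(** * Coverage by multiset sequents, and the rules it absorbs *)

(** The flag [b] is the side, [true] for the antecedent. The disjunction reflects the two premisses
    of the left rule for implication, the conjunction the single premiss of the right rule. Other
    formulas are covered by membership only. *)
Fixpoint cov (b : bool) (Γ Δ : ctx) (X : form) : bool :=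
  (X \in (if b then Γ else Δ)) ||
  (if X is Imp A B then
     if b then cov false Γ Δ A || cov true Γ Δ B
     else cov true Γ Δ A && cov false Γ Δ B
   else false).

Definition covers (Γ Δ : seq form) (Γ' Δ' : ctx) : Prop :=
  (forall X, X \in Γ -> cov true Γ' Δ' X) /\
  (forall X, X \in Δ -> cov false Γ' Δ' X).

Lemma mem_cov (b : bool) (Γ Δ : ctx) X :
  X \in (if b then Γ else Δ) -> cov b Γ Δ X.
Proof. by case: X => *; apply/orP; left. Qed.

Lemma cov_trans (Γ Δ Γ' Δ' : ctx) : covers Γ Δ Γ' Δ' ->
  forall X b, cov b Γ Δ X -> cov b Γ' Δ' X.
Proof.
case=> h1 h2; have h X (b : bool) : X \in (if b then Γ else Δ) -> cov b Γ' Δ' X.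
  by case: b; [apply: h1 | apply: h2].
elim=> [p||A IHA B IHB|A _ B _] b /orP[/h //|] //.
case: b => [/orP[/IHA|/IHB] k|/andP[/IHA k1 /IHB k2]] /=.
- by rewrite k orbT.
- by rewrite k !orbT.
- by rewrite k1 k2 orbT.
Qed.

Lemma covers_trans Γ Δ (Γ1 Δ1 Γ2 Δ2 : ctx) :
  covers Γ Δ Γ1 Δ1 -> covers Γ1 Δ1 Γ2 Δ2 -> covers Γ Δ Γ2 Δ2.
Proof. by case=> h1 h2 /cov_trans h; split=> X; [move/h1|move/h2]; apply: h. Qed.

Lemma covers_mem Γ Δ (Γ' Δ' : ctx) :
  {subset Γ <= Γ'} -> {subset Δ <= Δ'} -> covers Γ Δ Γ' Δ'.
Proof. by move=> s1 s2; split=> X hX; apply: mem_cov; [apply: s1 | apply: s2]. Qed.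

Lemma covers_cat Γ Δ Γe Δe (Γ' Δ' : ctx) :
  covers Γ Δ Γ' Δ' -> covers Γe Δe Γ' Δ' -> covers (Γe ++ Γ) (Δe ++ Δ) Γ' Δ'.
Proof.
move=> [h1 h2] [h3 h4].
by split=> X; rewrite mem_cat => /orP[]; auto.
Qed.

Lemma covers_ext Γ Δ (Γ1 Δ1 : ctx) Γe Δe (Γ2 Δ2 : ctx) :
  covers Γ Δ Γ1 Δ1 -> {subset Γ1 <= Γ2} -> {subset Δ1 <= Δ2} ->
  {subset Γe <= Γ2} -> {subset Δe <= Δ2} ->
  covers (Γe ++ Γ) (Δe ++ Δ) Γ2 Δ2.
Proof.
move=> h s1 s2 s3 s4; apply: covers_cat; last exact: covers_mem.
by apply: covers_trans h _; apply: covers_mem.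
Qed.

(** Quantifying over all covering sequents builds weakening and contraction into the property to be
    proved by induction on [der]. *)
Definition good L (Γ Δ : seq form) : Prop :=
  forall Γ' Δ', covers Γ Δ Γ' Δ' -> derivable (rules L) (Γ' ⇒ Δ').

Lemma good_sub L Γ Δ Γ' Δ' : good L Γ Δ ->
  {subset Γ <= Γ'} -> {subset Δ <= Δ'} -> good L Γ' Δ'.
Proof.
move=> h s1 s2 Γm Δm [h1 h2]; apply: h; split=> X hX; first exact/h1/s1.
exact/h2/s2.
Qed.

Lemma rules_prop L ps c : G_prop ps c -> rules L ps c.
Proof. by case: L => h; repeat first [exact: h | left]. Qed.

Lemma derivable_rcons G ps (p c : sequent) : G (rcons ps p) c ->
  (forall s, s \in ps -> derivable G s) -> derivable G p -> derivable G c.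
Proof.
move=> r h d; apply: (Derive r) => s; rewrite mem_rcons inE.
by case/orP=> [/eqP ->|/h].
Qed.

Lemma derivable_impL L (Γ Δ : ctx) A B :
  derivable (rules L) (Γ ⇒ A +` Δ) -> derivable (rules L) (B +` Γ ⇒ Δ) ->
  derivable (rules L) (Imp A B +` Γ ⇒ Δ).
Proof.
move=> d1 d2; have r : G_prop [:: Γ ⇒ A +` Δ; B +` Γ ⇒ Δ] (Imp A B +` Γ ⇒ Δ).
  by left; right.
apply: (Derive (rules_prop _ r)) => s; rewrite !inE.
by case/orP=> /eqP ->.
Qed.

Lemma good_init L Γ Δ p : Atom p \in Γ -> Atom p \in Δ -> good L Γ Δ.
Proof.
move=> h1 h2 Γ' Δ' [/(_ _ h1) /orP[k1|//] /(_ _ h2) /orP[k2|//]].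
rewrite -(msetB1K k1) -(msetB1K k2).
by apply: (@Derive _ [::]) => //; apply: rules_prop; do 3 left.
Qed.

Lemma good_bot L Γ Δ : Bot \in Γ -> good L Γ Δ.
Proof.
move=> h1 Γ' Δ' [/(_ _ h1) /orP[k1|//] _]; rewrite -(msetB1K k1).
by apply: (@Derive _ [::]) => //; apply: rules_prop; left; left; right.
Qed.

(** If the implication occurs in [Γ'], that copy is decomposed, and in each premiss its component
    covers what the copy covered. Otherwise it was decomposed before, and [Γ' ⇒ Δ'] covers one of
    the two premisses as it stands. *)
Lemma good_impL L Γ Δ A B : Imp A B \in Γ ->
  good L Γ (A :: Δ) -> good L (B :: Γ) Δ -> good L Γ Δ.
Proof.
move=> h g1 g2 Γ' Δ' c; case: (c) => c1 c2.
case/orP: (c1 _ h) => [k|/orP[k|k]].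
- move: c {c1 c2}; rewrite -(msetB1K k); set Γm := _ `\ _ => c.
  apply: derivable_impL.
  + apply: g1; apply: (@covers_cat _ _ [::] [:: A]); last first.
      by apply: covers_mem => //; clear; msub.
    apply: covers_trans c _; split=> X; rewrite mem_enum_mset.
      rewrite in_mset1D => /orP[/eqP ->|hX]; last exact: mem_cov.
      apply/orP; right; apply/orP; left.
      by apply: mem_cov; rewrite in_mset1D eqxx.
    by move=> hX; apply: mem_cov; rewrite in_mset1D hX orbT.
  + apply: g2; apply: (@covers_cat _ _ [:: B] [::]); last first.
      by apply: covers_mem => //; clear; msub.
    apply: covers_trans c _; split=> X; rewrite mem_enum_mset.
      rewrite in_mset1D => /orP[/eqP ->|hX]; last first.
        by apply: mem_cov; rewrite in_mset1D hX orbT.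
      apply/orP; right; apply/orP; right.
      by apply: mem_cov; rewrite in_mset1D eqxx.
    by move=> hX; apply: mem_cov.
- by apply: g1; split=> // X; rewrite inE => /orP[/eqP ->|/c2].
- by apply: g2; split=> // X; rewrite inE => /orP[/eqP ->|/c1].
Qed.

Lemma good_impR L Γ Δ A B : Imp A B \in Δ ->
  good L (A :: Γ) (B :: Δ) -> good L Γ Δ.
Proof.
move=> h g Γ' Δ' c; case: (c) => c1 c2.
case/orP: (c2 _ h) => [k|/andP[k1 k2]]; last first.
  by apply: g; split=> X; rewrite inE => /orP[/eqP ->|] //; auto.
move: c {c1 c2}; rewrite -(msetB1K k); set Δm := _ `\ _ => c.
have r : G_prop [:: A +` Γ' ⇒ B +` Δm] (Γ' ⇒ Imp A B +` Δm) by right.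
apply: (Derive (rules_prop _ r)) => s; rewrite inE => /eqP ->.
apply: g; apply: (@covers_cat _ _ [:: A] [:: B]); last first.
  by apply: covers_mem => //; clear; msub.
apply: covers_trans c _; split=> X; rewrite mem_enum_mset.
  by move=> hX; apply: mem_cov; rewrite in_mset1D hX orbT.
rewrite in_mset1D => /orP[/eqP ->|hX]; last first.
  by apply: mem_cov; rewrite in_mset1D hX orbT.
by apply/orP; right; apply/andP; split; apply: mem_cov; rewrite in_mset1D eqxx.
Qed.

(** A ≼-formula is never decomposed, so the modal rules find their principal formulas and boxed
    contexts in the multisets. *)
Lemma covers_prec Γ Δ (Γ' Δ' : ctx) X : covers Γ Δ Γ' Δ' -> is_prec X ->
  (X \in Γ -> X \in Γ') /\ (X \in Δ -> X \in Δ').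
Proof.
by move=> [h1 h2]; case: X => // A B _; split; [move/h1|move/h2] => /orP[].
Qed.

Lemma good_C0 L Γ Δ A B : has_C L -> A ≼ B \in Γ ->
  good L (A :: Γ) Δ -> good L Γ (B :: Δ) -> good L Γ Δ.
Proof.
move=> hC h g1 g2 Γ' Δ' c.
have k : A ≼ B \in Γ' by case: (@covers_prec _ _ _ _ (A ≼ B) c isT) => /(_ h).
move: c; rewrite -(msetB1K k); set Γm := _ `\ _ => c.
have r : rules L [:: [mset A ≼ B; A] `+` Γm ⇒ Δ'; (A ≼ B) +` Γm ⇒ B +` Δ']
    ((A ≼ B) +` Γm ⇒ Δ').
  by case: L hC {g1 g2} => //= _; right.
apply: (Derive r) => s; rewrite !inE => /orP[] /eqP ->.
- by apply: g1; apply: (@covers_ext _ _ _ _ [:: A] [::] _ _ c) => //; clear; msub.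
- by apply: g2; apply: (@covers_ext _ _ _ _ [::] [:: B] _ _ c) => //; clear; msub.
Qed.

(* The derivation of T_n from n applications of C_0. *)
Lemma good_C0_chain L Γ Δ S : has_C L -> {subset sigs S <= Γ} ->
  (forall C D S1 S2, S = S2 ++ (C, D) :: S1 ->
     good L (C :: Γ) (unzip2 S1 ++ Δ)) ->
  good L Γ (unzip2 S ++ Δ) -> good L Γ Δ.
Proof.
move=> hC; elim: S => [//|[C D] S IH] sS h g.
apply: IH.
- by move=> x hx; apply: sS; rewrite inE hx orbT.
- by move=> C' D' S1 S2 e; apply: (h C' D' S1 ((C, D) :: S2)); rewrite e.
- apply: (@good_C0 _ _ _ C D) => //; first by apply: sS; rewrite inE eqxx.
  exact: (h C D S [::]).
Qed.

(** * Blocks without repetitions and the modal rules on multisets *)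

(** [undup] keeps the last occurrence of [x], and the elements after it are the same with or without
    repetitions. *)
Lemma undup_split (T : eqType) (s s1 s2 : seq T) x :
  undup s = s2 ++ x :: s1 ->
  exists s1' s2', s = s2' ++ x :: s1' /\ s1' =i s1.
Proof.
elim: s s2 => [|y s IH] s2 /=; first by case: s2.
case: (boolP (y \in s)) => [_ /IH|_].
  by case=> s1' [s2' [-> e]]; exists s1', (y :: s2').
case: s2 => [[-> <-]|z s2 [_ /IH]].
  by exists s, [::]; split=> // z; rewrite mem_undup.
by case=> s1' [s2' [-> e]]; exists s1', (y :: s2').
Qed.

(* A block of [der] may repeat a pair that the multiset contains only once:
   dropping all but the first use of a pair leaves the same sets of [D_i]. *)
Lemma good_chain L S Γ Δ (Γm Δm : ctx) :
  (forall C D S1 S2, S = S2 ++ (C, D) :: S1 ->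
     good L (C :: Γ) (unzip2 S1 ++ Δ)) ->
  covers Γ Δ Γm Δm ->
  forall s, s \in chain Γm Δm (rev (undup S)) -> derivable (rules L) s.
Proof.
move=> h c s /mem_chain[C [D [S1 [S2 [e ->]]]]].
have {}e : undup S = rev S2 ++ (C, D) :: rev S1.
  by rewrite -[undup S]revK e rev_cat rev_cons cat_rcons.
have [S1' [S2' [eS eS1]]] := undup_split e.
apply: (h _ _ _ _ eS).
apply: (@covers_ext _ _ _ _ [:: C] (unzip2 S1') _ _ c); try by clear; msub.
have eu : unzip2 S1' =i unzip2 S1.
  by move=> x; rewrite -(mem_unzip2_rev S1); apply: eq_mem_map.
by move=> x; rewrite eu; clear; msub.
Qed.

(** Without repetitions every formula of the block has multiplicity one, so membership gives
    multiset inclusion. *)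
Lemma Sig_undup_sub Γ Δ (Γ' Δ' : ctx) S : covers Γ Δ Γ' Δ' ->
  {subset sigs S <= Γ} -> Sig (rev (undup S)) `<=` Γ'.
Proof.
move=> c sS; apply/msubsetP => x; rewrite mset_seqE.
have inj : injective (fun P : form * form => P.1 ≼ P.2).
  by case=> a b [a' b'] [-> ->].
rewrite count_uniq_mem ?map_inj_uniq ?rev_uniq ?undup_uniq //.
case: (boolP (x \in _)) => //= hx; rewrite mset_gt0.
have {}hx : x \in sigs S.
  by case/mapP: hx => q; rewrite mem_rev mem_undup => hq ->; apply: map_f.
by case: (covers_prec c (is_prec_sigs hx)) => /(_ (sS _ hx)).
Qed.

Lemma mem_unzip2_undup (S : block) x :
  (x \in unzip2 (rev (undup S))) = (x \in unzip2 S).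
Proof. by apply: eq_mem_map => q; rewrite mem_rev mem_undup. Qed.

Lemma size_rev_undup_gt0 (S : block) : S <> [::] -> 0 < size (rev (undup S)).
Proof.
by move=> nS; rewrite size_rev lt0n size_eq0; apply/eqP => /undup_nil.
Qed.

Lemma rules_CP L n ps c : is_abs L = false -> CP_rule n ps c -> rules L ps c.
Proof.
move=> nab r; have h : G_N ps c by right; exists n.
by case: L nab => // _; repeat first [exact: h | left].
Qed.

Lemma rules_N L n ps c : is_abs L = false -> has_N L -> 0 < n ->
  N_rule n ps c -> rules L ps c.
Proof. by case: L => // _ _ hn r; right; exists n. Qed.

Lemma rules_T L n ps c : has_C L = false -> has_T L -> 0 < n ->
  T_rule n ps c -> rules L ps c.
Proof. by case: L => // _ _ hn r; right; exists n. Qed.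

Lemma rules_W L n ps c : has_C L = false -> has_W L ->
  W_rule n ps c -> rules L ps c.
Proof. by case: L => // _ _ r; left; right; exists n. Qed.

Lemma rules_W0 L ps c : has_C L -> W_rule 0 ps c -> rules L ps c.
Proof. by case: L => // _ r; left; right. Qed.

Lemma rules_A L n ps c : is_abs L -> A_rule n ps c -> rules L ps c.
Proof.
move=> ab r; have h : G_NA ps c by right; exists n.
by case: L ab => // _; repeat first [exact: h | left].
Qed.

Lemma rules_NA L n ps c : is_abs L -> has_N L -> 0 < n ->
  NA_rule n ps c -> rules L ps c.
Proof. by case: L => // _ _ hn r; right; exists n. Qed.

(** The multiset rule is applied with the block [rev (undup S)], which is split off from [Γ']; its
    premisses cover those of the jump. *)
Lemma good_jump L Γ Δ o S :
  jump_ok L o -> principal o Δ -> {subset sigs S <= Γ} ->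
  (forall C D S1 S2, S = S2 ++ (C, D) :: S1 ->
     good L (C :: box L Γ) (unzip2 S1 ++ succ_of o ++ box L Δ)) ->
  good L (ante_of o ++ box L Γ) (unzip2 S ++ succ_of o ++ box L Δ) ->
  good L Γ Δ.
Proof.
move=> ok pr sS gc g Γ' Δ' c.
have sT := Sig_undup_sub c sS.
have sU : {subset unzip2 S <= unzip2 (rev (undup S))}.
  by move=> x; rewrite mem_unzip2_undup.
have nT := @size_rev_undup_gt0 S.
have hC := good_chain gc.
move: (rev (undup S)) sT sU nT hC => T sT sU nT hC.
have eT := Ds_size (erefl (size T)).
have eΓ := msetBDK sT; set Γm := Γ' `\` Sig T in eΓ.
have [ab|nab] := boolP (is_abs L); last first.
  move/negbTE: nab => nab.
  have eb X : box L X = [::] by rewrite /box nab.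
  rewrite !eb !cats0 in g hC.
  case: o ok pr gc g hC => [[A B]|] /= ok pr gc g hC.
    have [_ /(_ pr) k] := @covers_prec _ _ _ _ (A ≼ B) c isT.
    rewrite -eΓ -(msetB1K k).
    apply: derivable_rcons.
    + by apply: (rules_CP nab); apply: CP_intro.
    + by apply: hC; apply: covers_mem; clear; msub.
    + by apply: g; apply: covers_mem; rewrite ?eT; clear -sU; msub.
  (* The N-rules start at n = 1; with an empty block the last premiss is already covered by the
     conclusion. *)
  case: (S =P [::]) => [S0|/nT {}nT].
    by apply: g; rewrite S0; split.
  rewrite -eΓ; apply: derivable_rcons.
  + by apply: (rules_N nab ok nT); apply: N_intro.
  + by apply: hC; apply: covers_mem; clear; msub.
  + by apply: g; apply: covers_mem; rewrite ?eT; clear -sU; msub.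
have sΓ : {subset box L Γ <= precs Γm `+` Sig T}.
  move=> x; rewrite mem_box_abs // => /andP[px hx].
  have [/(_ hx) k _] := covers_prec c px.
  by move: k; rewrite -eΓ !in_msetD mem_precs px.
have sΔ : {subset box L Δ <= precs Δ'}.
  move=> x; rewrite mem_box_abs // => /andP[px hx].
  by have [_ /(_ hx) k] := covers_prec c px; rewrite mem_precs px.
case: o ok pr gc g hC => [[A B]|] /= ok pr gc g hC.
  have [_ /(_ pr) k] := @covers_prec _ _ _ _ (A ≼ B) c isT.
  (* The copy of [A ≼ B] taken out of [Δ'] may be the only one, but A_n repeats it in its
     premisses. *)
  have {}sΔ : {subset box L Δ <= [mset A ≼ B; A] `+` precs (Δ' `\ (A ≼ B))}.
    move=> x /sΔ; rewrite mem_precs => /andP[px].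
    rewrite -{1}(msetB1K k) !in_msetD mem_precs px !in_msetn /=.
    by case/orP=> ->; rewrite ?orbT.
  rewrite -eΓ -(msetB1K k).
  apply: derivable_rcons.
  + by apply: (rules_A ab); apply: A_intro.
  + apply: hC; apply: covers_mem => // x; rewrite inE => /orP[/eqP ->|/sΔ //].
    by rewrite !in_msetE eqxx orbT.
  + apply: g; apply: covers_mem.
      by move=> x; rewrite inE in_msetD in_msetn => /orP[->|/sΓ ->] //;
         rewrite ?orbT.
    move=> x; rewrite mem_cat inE in_msetD eT [x \in seq_mset (unzip2 _)]mem_seq_mset.
    case/or3P=> [/sU ->|/eqP ->|/sΔ ->] //; first by rewrite orbT.
    by rewrite !in_msetE eqxx !orbT.
case: (S =P [::]) => [S0|/nT {}nT].
  apply: g; rewrite S0; split=> x; rewrite mem_box_abs // => /andP[px hx];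
  by have [k1 k2] := covers_prec c px; apply: mem_cov; auto.
rewrite -eΓ; apply: derivable_rcons.
- by apply: (rules_NA ab ok nT); apply: NA_intro.
- by apply: hC; apply: covers_mem.
- apply: g; apply: covers_mem => // x.
  rewrite mem_cat in_msetD eT [x \in seq_mset (unzip2 _)]mem_seq_mset.
  by case/orP=> [/sU|/sΔ] ->; rewrite ?orbT.
Qed.

(** In NC the block is used up by C_0 and a principal formula is then treated by W_0. In NT and NW
    the rule itself is applied to the block without repetitions. *)
Lemma good_stay L Γ Δ o S :
  stay_ok L o -> principal o Δ -> {subset sigs S <= Γ} ->
  (forall C D S1 S2, S = S2 ++ (C, D) :: S1 ->
     good L [:: C] (unzip2 S1 ++ succ_of o)) ->
  good L Γ (unzip2 S ++ succ_of o ++ Δ) -> good L Γ Δ.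
Proof.
move=> ok pr sS gc g.
have [hC|/negbTE nC] := boolP (has_C L).
  have {}g : good L Γ (succ_of o ++ Δ).
    apply: (good_C0_chain hC sS) g => C D S1 S2 e.
    by apply: (good_sub (gc _ _ _ _ e)); clear; sub.
  case: o {ok gc} pr g => [[A B]|] //= pr g Γ' Δ' c.
  have [_ /(_ pr) k] := @covers_prec _ _ _ _ (A ≼ B) c isT.
  have eΓ : Γ' `+` Sig [::] = Γ'.
    rewrite -[RHS]msetD0; congr (_ `+` _).
    by apply/msetP => x; rewrite mset_seqE mset0E.
  rewrite -eΓ -(msetB1K k).
  apply: derivable_rcons.
  + by apply: (rules_W0 hC); apply: W_intro.
  + by [].
  + rewrite eΓ; apply: g.
    apply: (@covers_ext _ _ _ _ [::] [:: A] _ _ c) => //; last by clear; msub.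
    by rewrite -{1}(msetB1K k); clear; msub.
move=> Γ' Δ' c.
have sT := Sig_undup_sub c sS.
have sU : {subset unzip2 S <= unzip2 (rev (undup S))}.
  by move=> x; rewrite mem_unzip2_undup.
have nT := @size_rev_undup_gt0 S.
have hC := good_chain gc.
move: (rev (undup S)) sT sU nT hC => T sT sU nT hC.
have eT := Ds_size (erefl (size T)).
have eΓ := msetBDK sT; set Γm := Γ' `\` Sig T in eΓ.
case: o ok pr gc g hC => [[A B]|] /= ok pr gc g hC.
  have [_ /(_ pr) k] := @covers_prec _ _ _ _ (A ≼ B) c isT.
  rewrite -eΓ -(msetB1K k).
  apply: derivable_rcons.
  + by apply: (rules_W nC ok); apply: W_intro.
  + by apply: hC; apply: covers_mem; clear; msub.
  + rewrite eΓ; apply: (good_sub (Γ' := Γ) (Δ' := (unzip2 S ++ [:: A]) ++ Δ) g).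
    * by [].
    * by clear; sub.
    apply: (@covers_ext _ _ _ _ [::] _ _ _ c) => //.
      by rewrite -{1}(msetB1K k); clear; msub.
    by rewrite eT; clear -sU; msub.
case: (S =P [::]) => [S0|/nT {}nT].
  by apply: g; rewrite S0.
rewrite -eΓ; apply: derivable_rcons.
- by apply: (rules_T nC ok nT); apply: T_intro.
- by apply: hC; apply: covers_mem; clear; msub.
- rewrite eΓ; apply: g.
  apply: (@covers_ext _ _ _ _ [::] _ _ _ c) => //; first by clear; msub.
  by rewrite eT; clear -sU; msub.
Qed.

Lemma good_of_der L Γ Δ : der L Γ Δ -> good L Γ Δ.
Proof.
elim=> {Γ Δ}.
- exact: good_init.
- exact: good_bot.
- by move=> Γ Δ A B h _ g1 _ g2; apply: good_impL h g1 g2.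
- by move=> Γ Δ A B h _ g; apply: good_impR h g.
- by move=> Γ Δ o S ok pr sS _ gc _ g; apply: good_jump ok pr sS gc g.
- by move=> Γ Δ o S ok pr sS _ gc _ g; apply: good_stay ok pr sS gc g.
- by move=> Γ Δ A B hC h _ g1 _ g2; apply: good_C0 hC h g1 g2.
Qed.

Theorem theorem4p3 (L : calculus) : admissible (rules L) cut.
Proof.
move=> _ _ [Γ Γ' Δ Δ' A] h.
have d1 := der_of_derivable (h _ (mem_head _ _)).
have d2 := der_of_derivable (h (_, _) (mem_last _ [:: _])).
have d : der L (Γ `+` Γ') (Δ `+` Δ').
  by apply: (cut_sub (@cut_der L A) d1 d2) => /=; clear; msub.
by apply: (good_of_der d); apply: covers_mem.
Qed.
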